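(* Let $(c_{r,s})_{r,s\in\mathbb{Z}}$ be complex numbers and let $\ell,k\in\mathbb{Z}$, and assume that all infinite series appearing below converge absolutely. Then $$\sum_{\mathrm{sg}(r)=\mathrm{sg}(s)}c_{r,s}=\sum_{\mathrm{sg}(r)=\mathrm{sg}(s)} c_{-1-r,-1-s},$$ and $$\sum_{\mathrm{sg}(r)=\mathrm{sg}(s)}c_{r,s}=\sum_{\mathrm{sg}(r)=\mathrm{sg}(s)}c_{r+\ell,s+k}+\sum_{r=0}^{\ell-1}\sum_{s\in \mathbb{Z}}\mathrm{sg}(s)\,c_{r,s}+\sum_{s=0}^{k-1}\sum_{r\in \mathbb{Z}}\mathrm{sg}(r)\,c_{r,s}-2\sum_{r=0}^{\ell-1}\sum_{s=0}^{k-1}c_{r,s}.$$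
   Context: For an integer $r$, $\mathrm{sg}(r)=1$ if $r\ge 0$ and $\mathrm{sg}(r)=-1$ if $r<0$. The sum $\sum_{\mathrm{sg}(r)=\mathrm{sg}(s)}$ runs over all $(r,s)\in\mathbb{Z}^2$ with $\mathrm{sg}(r)=\mathrm{sg}(s)$, i.e. either $r,s\ge 0$ or $r,s<0$. Convention for finite sums: when $b<a$, $\sum_{r=a}^{b}c_r:=-\sum_{r=b+1}^{a-1}c_r$ (in particular $\sum_{r=a}^{a-1}c_r=0$), so that e.g. $\sum_{r=0}^{\ell-1}$ is defined for every $\ell\in\mathbb{Z}$. *)

(* Defs.v *)
From HB Require Import structures.
From mathcomp Require Import all_boot all_order all_algebra.
From mathcomp Require Import complex.
From mathcomp Require Import all_classical all_reals all_analysis.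

Set Implicit Arguments.
Unset Strict Implicit.
Unset Printing Implicit Defensive.

Import Order.TTheory GRing.Theory Num.Theory.
Import numFieldNormedType.Exports.

Local Open Scope classical_set_scope.
Local Open Scope ring_scope.
Local Open Scope complex_scope.

(* Unlike [sgz], the value at 0 is 1. *)
Definition sg (r : int) : int := if 0 <= r then 1 else -1.

Definition same_sg : set (int * int) := [set p | sg p.1 = sg p.2].

(* The finite subsets of D, directed by inclusion. *)
Definition finite_subsets (I : choiceType) (D : set I) : set_system (set I) :=
  filter_from (fsets D) (fun A => [set B | fsets D B /\ A `<=` B]).

(* Sum of an unordered family: the limit of its finite partial sums. As [lim]
   is total, the value is meaningful only when these converge, which over R[i]
   they do when the family is absolutely summable. *)
Definition csum (K : numFieldType) (I : choiceType) (D : set I) (f : I -> K)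
    : K :=
  lim (\sum_(x \in A) f x @[A --> finite_subsets D]).

(* [summable] takes real values, hence the R-valued modulus [Normc.normc]
   rather than the R[i]-valued norm. *)
Definition abs_summable (R : realType) (I : choiceType) (D : set I)
    (f : I -> R[i]) : Prop :=
  summable D (fun x => (Normc.normc (f x))%:E).

(* Sum of F r for r from a to b, equal when b < a to minus the sum for r from
   b + 1 to a - 1. *)
Definition zsum (V : zmodType) (a b : int) (F : int -> V) : V :=
  if a <= b then \sum_(i < absz (b - a + 1)%R) F (a + i%:Z)
  else - \sum_(i < absz (a - b - 1)%R) F (b + 1 + i%:Z).

(* The indices r of the terms F r that occur in [zsum a b F]. *)
Definition zsum_range (a b : int) : set int :=
  [set r | a <= r <= b \/ b + 1 <= r <= a - 1].

(* Main.v *)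
(* With chi(r, s) = (1 + sg r sg s) / 2 the indicator of sg r = sg s, both sums
   over same-sign pairs are sums of c over all of Z^2, weighted by chi(r, s) and
   chi(r - l, s - k).  Since sg (r - l) = sg r - 2 e(r), where e is the signed
   indicator of the range 0 .. l - 1, and likewise sg (s - k) = sg s - 2 e'(s),
   chi(r, s) - chi(r - l, s - k) = e(r) sg s + e'(s) sg r - 2 e(r) e'(s)
   pointwise; summing against c gives the shift formula. The reflection formula
   is a reindexing by an involution that preserves same-sign pairs. *)

Require Import Defs.
From HB Require Import structures.
From mathcomp Require Import all_boot all_order all_algebra.
From mathcomp Require Import complex.
From mathcomp Require Import all_classical all_reals all_analysis.
From mathcomp Require Import zify ring lra.

Set Implicit Arguments.
Unset Strict Implicit.
Unset Printing Implicit Defensive.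

Import Order.TTheory GRing.Theory Num.Theory.
Import numFieldNormedType.Exports.

Local Open Scope classical_set_scope.
Local Open Scope ring_scope.
Local Open Scope complex_scope.

(** * Unordered sums as limits along finite subsets *)

#[global] Instance finite_subsets_filter (I : choiceType) (D : set I) :
  ProperFilter (finite_subsets D).
Proof.
apply: filter_from_proper => [|A DA]; last by exists A; split.
apply: filter_from_filter => [|A B [finA AD] [finB BD]].
  by exists set0; split.
exists (A `|` B); first by split; [rewrite finite_setU | rewrite subUset].
by move=> C [DC]; rewrite subUset => -[AC BC].
Qed.

Lemma near_finite_subsets (I : choiceType) (D : set I) :
  \forall A \near finite_subsets D, fsets D A.
Proof. by exists set0; [split | move=> A []]. Qed.

(** Since [csum] is a total [lim], its value alone does not record convergence. This relation holds
    convergence and value together, so the limit laws apply to it, and [csumE] leads back to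
    [csum]. *)
Definition has_csum (K : numFieldType) (I : choiceType) (D : set I)
    (f : I -> K) (x : K) : Prop :=
  \sum_(i \in A) f i @[A --> finite_subsets D] --> x.

Section has_csum_theory.
Variables (K : numFieldType) (I : choiceType) (D : set I).
Implicit Types (f g : I -> K) (x y : K).

Lemma csumE f x : has_csum D f x -> csum D f = x.
Proof. by move=> fx; apply: cvg_lim => //; exact: norm_hausdorff. Qed.

Lemma eq_has_csum f g x : {in D, f =1 g} -> has_csum D f x -> has_csum D g x.
Proof.
move=> fg; apply: cvg_trans; apply: near_eq_cvg.
apply: filterS (near_finite_subsets D) => A [_ AD].
by apply: eq_fsbigr => i /set_mem Ai; apply: fg; apply/mem_set/AD.
Qed.

Lemma has_csum0 : has_csum D (fun=> 0 : K) 0.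
Proof.
rewrite /has_csum; under eq_cvg do rewrite fsbig1//.
exact: cvg_cst.
Qed.

Lemma has_csumD f g x y :
  has_csum D f x -> has_csum D g y -> has_csum D (fun i => f i + g i) (x + y).
Proof.
move=> fx gy; apply: cvg_trans (cvgD fx gy); apply: near_eq_cvg.
apply: filterS (near_finite_subsets D) => A [finA _].
by rewrite fsbig_split.
Qed.

Lemma has_csumZ (a : K) f x :
  has_csum D f x -> has_csum D (fun i => a * f i) (a * x).
Proof.
move=> fx; rewrite /has_csum; under eq_cvg do rewrite -mulr_fsumr.
exact: cvgMr.
Qed.

Lemma has_csumN f x : has_csum D f x -> has_csum D (fun i => - f i) (- x).
Proof.
move=> fx; rewrite -mulN1r; apply: eq_has_csum (has_csumZ fx) => i _.
by rewrite mulN1r.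
Qed.

Lemma has_csum_sum n (F : 'I_n -> I -> K) (X : 'I_n -> K) :
  (forall j, has_csum D (F j) (X j)) ->
  has_csum D (fun i => \sum_(j < n) F j i) (\sum_(j < n) X j).
Proof.
elim: n F X => [|n IHn] F X FX.
  rewrite big_ord0; apply: eq_has_csum has_csum0 => i _.
  by rewrite big_ord0.
rewrite big_ord_recr.
have FXn := IHn _ _ (fun j => FX (widen_ord (leqnSn n) j)).
apply: eq_has_csum (has_csumD FXn (FX ord_max)) => i _.
by rewrite big_ord_recr.
Qed.

Lemma has_csum_zsum a b (F : int -> I -> K) (X : int -> K) :
  (forall r, zsum_range a b r -> has_csum D (F r) (X r)) ->
  has_csum D (fun i => zsum a b (F ^~ i)) (zsum a b X).
Proof.
move=> FX; rewrite /zsum; case: ifPn => ab.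
  by apply: has_csum_sum => j; apply: FX; left; have := ltn_ord j; lia.
apply/has_csumN/has_csum_sum => j; apply: FX; right.
by have := ltn_ord j; lia.
Qed.

End has_csum_theory.

(** A finite [A] in [D] has the same partial sum as its preimage in [E], because injectivity matches
    the terms on the image and the others vanish. These preimages eventually contain any given
    finite subset of [E]. *)
Lemma has_csum_reindex (K : numFieldType) (I J : choiceType) (D : set I)
    (E : set J) (h : J -> I) (f : I -> K) x :
  {in E &, injective h} -> h @` E `<=` D ->
  (forall i, D i -> ~ (h @` E) i -> f i = 0) ->
  has_csum E (f \o h) x -> has_csum D f x.
Proof.
move=> inj_h hED f0.
have finE A : finite_set A -> finite_set (E `&` h @^-1` A).
  move=> finA.
  have inj_hA : {in E `&` h @^-1` A &, injective h}.
    move=> i j /set_mem[Ei _] /set_mem[Ej _]; apply: inj_h; exact: mem_set.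
  rewrite -(eq_finite_set (inj_card_eq inj_hA)).
  by apply: sub_finite_set finA => _ [j [_ hjA] <-].
have pre : (E `&` h @^-1` A) @[A --> finite_subsets D] --> finite_subsets E.
  (* Once [A] contains the image of [B], its preimage contains [B]. *)
  move=> P [B [finB BE] BP]; exists (h @` B).
    split; first exact: finite_image.
    by apply: subset_trans hED; exact: image_subset.
  move=> A [[finA AD] hBA]; apply: BP; split.
    by split; [exact: finE | move=> j []].
  by move=> j Bj; split; [exact: BE | apply: hBA; exists j].
move=> fx; apply: cvg_trans (cvg_comp _ _ pre fx); apply: near_eq_cvg.
apply: filterS (near_finite_subsets D) => A [finA AD] /=.
have bij : set_bij (E `&` h @^-1` A) (h @` E `&` A) h.
  split.
  - by move=> j [Ej Aj]; split=> //; exists j.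
  - move=> i j /set_mem[Ei _] /set_mem[Ej _]; apply: inj_h; exact: mem_set.
  - by move=> i [[j Ej <-] Aj]; exists j.
rewrite -(reindex_fsbig _ _ _ f bij); apply: fsbig_widen => // i [Ai nhi] /=.
by apply: f0; [exact: AD | move=> hi; apply: nhi].
Qed.

Lemma has_csum_set1 (K : numFieldType) (I : choiceType) (i : I) (f : I -> K) :
  has_csum [set i] f (f i).
Proof.
apply: cvg_near_cst; exists [set i]; first by split.
move=> A [[_ Ai] iA].
have -> : A = [set i] by apply/seteqP.
by rewrite fsbig_set1.
Qed.

(** * Convergence of absolutely summable families *)

Section absolute_convergence.
Variables (R : realType) (I : choiceType) (D : set I).

(** Partial sums grow with the finite set, so they converge to their supremum. *)
Lemma nneg_has_csum (f : I -> R) M :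
  (forall i, D i -> 0 <= f i) ->
  (forall A, fsets D A -> \sum_(i \in A) f i <= M) ->
  exists x, has_csum D f x.
Proof.
move=> f0 fM; set S := [set \sum_(i \in A) f i | A in fsets D].
have ubS : has_ubound S by exists M => _ [A DA <-]; exact: fM.
have supS : has_sup S.
  by split=> //; exists (\sum_(i \in set0) f i); exists set0 => //; split.
exists (sup S); apply/cvgrPdist_lt => e e0.
have [_ [A [finA AD] <-] Ae] := sup_adherent e0 supS.
exists A => // B [[finB BD] AB].
have leB : \sum_(i \in B) f i <= sup S by apply: ub_le_sup => //; exists B.
have AleB : \sum_(i \in A) f i <= \sum_(i \in B) f i.
  rewrite -lee_fin -!fsumEFin//; apply: lee_fsum_nneg_subset => //.
    by move=> i /set_mem Ai; apply/mem_set/AB.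
  move=> i; rewrite inE => /andP[_ /set_mem Bi].
  by rewrite lee_fin; apply/f0/BD.
by rewrite ger0_norm ?subr_ge0//; lra.
Qed.

(** Write [f] as [(g + f) - g]: both families are nonnegative, with partial sums bounded by [M + M]
    and [M]. *)
Lemma dominated_has_csum (f g : I -> R) M :
  (forall i, D i -> `|f i| <= g i) ->
  (forall A, fsets D A -> \sum_(i \in A) g i <= M) ->
  exists x, has_csum D f x.
Proof.
move=> fg gM.
have [|x gx] := nneg_has_csum (f := g) _ gM.
  by move=> i Di; apply: le_trans (fg i Di).
have [||y gfy] := nneg_has_csum (f := fun i => g i + f i) (M := M + M).
- by move=> i Di; have := fg i Di; rewrite ler_norml => /andP[]; lra.
- move=> A DA; have [finA AD] := DA; rewrite fsbig_split//=.
  (* Nonnegativity of [g - f] bounds the sum of [f] by that of [g]; the factor [-1] is there to be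
     pulled out of the sum. *)
  have : 0 <= \sum_(i \in A) (g i + -1 * f i).
    by apply: fsumr_ge0 => i /AD /fg; rewrite ler_norml => /andP[]; lra.
  rewrite fsbig_split//= -mulr_fsumr.
  by have := gM A DA; lra.
exists (y - x); apply: eq_has_csum (has_csumD gfy (has_csumN gx)) => i _.
by rewrite addrAC subrr add0r.
Qed.

Lemma has_csum_real_complex (f : I -> R) (x : R) :
  has_csum D f x -> has_csum D (fun i => (f i)%:C) (x%:C).
Proof.
move=> /cvgrPdist_lt fx; apply/cvgrPdist_lt => -[e ei].
(* A positive element of [R[i]] has zero imaginary part, so the tolerance is real. *)
rewrite ltcE/= => /andP[/eqP -> e0].
near=> A; have [finA _] : fsets D A by near: A; exact: near_finite_subsets.
have -> : \sum_(i \in A) (f i)%:C = (\sum_(i \in A) f i)%:C.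
  by rewrite !fsbig_finite// raddf_sum.
rewrite -rmorphB normc_def/= expr0n addr0 sqrtr_sqr ltcE/= eqxx/=.
by near: A; exact: fx.
Unshelve. all: by end_near. Qed.

(** The modulus dominates the real and imaginary parts, which therefore converge separately. *)
Lemma has_csum_csum (f : I -> R[i]) :
  abs_summable D f -> has_csum D f (csum D f).
Proof.
move=> sumf; set n := fun i => Normc.normc (f i).
have n0 i : 0 <= n i by rewrite /n; case: (f i) => a b; exact: sqrtr_ge0.
have nM A : fsets D A -> \sum_(i \in A) n i <= fine (\esum_(i in D) (n i)%:E).
  move=> DA; have [finA _] := DA.
  have en : \esum_(i in D) (n i)%:E = \esum_(i in D) `|(n i)%:E|%E.
    by apply: eq_esum => i _; rewrite gee0_abs ?lee_fin.
  rewrite -lee_fin fineK; last by rewrite en -summableE.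
  by rewrite -fsumEFin//; apply: ereal_sup_ubound; exists A.
have [|x fx] := dominated_has_csum (f := fun i => complex.Re (f i)) _ nM.
  move=> i _; rewrite /n; case: (f i) => a b /=.
  by rewrite -sqrtr_sqr ler_sqrt ?lerDl ?addr_ge0 ?sqr_ge0.
have [|y fy] := dominated_has_csum (f := fun i => complex.Im (f i)) _ nM.
  move=> i _; rewrite /n; case: (f i) => a b /=.
  by rewrite -sqrtr_sqr ler_sqrt ?lerDr ?addr_ge0 ?sqr_ge0.
(* Convergence to the [lim] follows from the existence of any limit. *)
apply/cvg_ex; exists (x%:C + 'i%C * y%:C).
have := has_csumD (has_csum_real_complex fx)
  (has_csumZ (a := 'i%C) (has_csum_real_complex fy)).
by apply: eq_has_csum => i _; rewrite -complexE.
Qed.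

End absolute_convergence.

(** * Signed indicators of the finite ranges *)

(** The coefficient with which [zsum a b] counts the index [x]. The two intervals are never both
    inhabited, so it is 1, -1 or 0; for [a = 0] and [b = l - 1] it is the indicator [e] of the
    overview. *)
Definition zsum_sign (a b x : int) : int :=
  (a <= x <= b)%R%:Z - (b + 1 <= x <= a - 1)%R%:Z.

Lemma sum_ord_delta (V : pzRingType) (a x : int) (g : int -> V) n :
  \sum_(i < n) (a + i%:Z == x)%R%:R * g (a + i%:Z)
    = (a <= x < a + n%:Z)%R%:R * g x.
Proof.
elim: n => [|n IHn].
  by rewrite big_ord0 (_ : (_ <= _ < _) = false) ?mul0r//; lia.
rewrite big_ord_recr/= IHn; have [<-|neq] := eqVneq (a + n%:Z) x.
  rewrite (_ : (_ <= _ < a + n%:Z) = false); last by lia.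
  by rewrite mul0r add0r (_ : (_ <= _ < _) = true)//; lia.
by rewrite mul0r addr0; congr ((nat_of_bool _)%:R * _); lia.
Qed.

(** This turns a finite sum of families, each supported on one line of the plane, into a pointwise
    weight. *)
Lemma zsum_delta (V : pzRingType) a b (x : int) (g : int -> V) :
  zsum a b (fun r => (r == x)%:R * g r) = (zsum_sign a b x)%:~R * g x.
Proof.
rewrite /zsum /zsum_sign; case: ifPn => ab; rewrite sum_ord_delta.
  rewrite (_ : (b + 1 <= _ <= _) = false); last by lia.
  by rewrite subr0 (_ : (_ <= x < _) = (a <= x <= b))//; lia.
rewrite (_ : (a <= x <= b) = false); last by lia.
rewrite sub0r rmorphN mulNr.
by rewrite (_ : (_ <= x < _) = (b + 1 <= x <= a - 1))//; lia.
Qed.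

Lemma same_sg_shift (l k r s : int) :
  (sg r == sg s)%R%:Z = (sg (r - l) == sg (s - k))%R%:Z
    + zsum_sign 0 (l - 1) r * sg s + zsum_sign 0 (k - 1) s * sg r
    - 2 * (zsum_sign 0 (l - 1) r * zsum_sign 0 (k - 1) s).
Proof.
(* Shifting by [m] changes the sign exactly between 0 and [m]: from 1 to -1 if [m] is positive, from
   -1 to 1 if [m] is negative. *)
have sgE (m x : int) : sg (x - m) = sg x - 2 * zsum_sign 0 (m - 1) x.
  by rewrite /sg /zsum_sign; do 2 case: ifP; lia.
(* The indicator is doubled to stay within the integers; the factor 2 is cancelled at the end. *)
have chiE x y : 2 * (sg x == sg y)%R%:Z = 1 + sg x * sg y.
  by rewrite /sg; do 2 case: ifP.
have := chiE r s; have := chiE (r - l) (s - k).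
move: (sg (r - l) == sg (s - k))%R%:Z (sg r == sg s)%R%:Z => B A.
rewrite !sgE; move: (zsum_sign 0 (l - 1) r) (zsum_sign 0 (k - 1) s).
move=> e e' chiB chiA.
have {}chiB : 2 * (B + e * sg s + e' * sg r - 2 * (e * e')) = 1 + sg r * sg s.
  by rewrite mulrBr !mulrDr chiB; ring.
by apply: (@mulfI _ 2) => //; rewrite chiB.
Qed.

(** * Reflection and shift of sums over same-sign pairs *)

Theorem proposition2p3 (R : realType) (c : int -> int -> R[i]) (l k : int)
  (hc : abs_summable same_sg (fun p => c p.1 p.2))
  (hc_refl : abs_summable same_sg (fun p => c (-1 - p.1) (-1 - p.2)))
  (hc_shift : abs_summable same_sg (fun p => c (p.1 + l) (p.2 + k)))
  (hc_row : forall r : int, zsum_range 0 (l - 1) r ->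
    abs_summable [set: int] (fun s => (sg s)%:~R * c r s))
  (hc_col : forall s : int, zsum_range 0 (k - 1) s ->
    abs_summable [set: int] (fun r => (sg r)%:~R * c r s)) :
  csum same_sg (fun p => c p.1 p.2)
    = csum same_sg (fun p => c (-1 - p.1) (-1 - p.2))
  /\
  csum same_sg (fun p => c p.1 p.2)
    = csum same_sg (fun p => c (p.1 + l) (p.2 + k))
      + zsum 0 (l - 1) (fun r => csum [set: int] (fun s => (sg s)%:~R * c r s))
      + zsum 0 (k - 1) (fun s => csum [set: int] (fun r => (sg r)%:~R * c r s))
      - 2 * zsum 0 (l - 1) (fun r => zsum 0 (k - 1) (fun s => c r s)).
Proof.
have c1 := has_csum_csum hc.
split.
  apply: csumE.
  pose h (p : int * int) := (-1 - p.1, -1 - p.2).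
  have hh p : h (h p) = p by case: p => r s; congr pair; rewrite /=; lia.
  (* Because of the offset -1, the map [r] to [-1 - r] flips every sign, including that of 0, so
     equal signs stay equal. *)
  have hsg p : same_sg p -> same_sg (h p).
    by case: p => r s; rewrite /same_sg /h /sg/=; do 4 case: ifP; lia.
  apply: (has_csum_reindex (h := h)) (has_csum_csum hc_refl).
  - by move=> p q _ _ hpq; rewrite -(hh p) hpq hh.
  - by move=> _ [p Dp <-]; exact: hsg.
  - by move=> p Dp []; exists (h p) => //; exact: hsg.
(* [C1] to [C5] express each sum of the shift formula as a sum over the whole plane, so that they
   can be combined termwise. *)
have C1 : has_csum [set: int * int]
    (fun p => (sg p.1 == sg p.2)%R%:Z%:~R * c p.1 p.2)
    (csum same_sg (fun p => c p.1 p.2)).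
  apply: (has_csum_reindex (E := same_sg) (h := id)) => //.
  - move=> p _ np; rewrite (_ : (_ == _) = false) ?mul0r//.
    by apply/eqP => Dp; apply: np; exists p.
  - by apply: eq_has_csum c1 => p /set_mem Dp /=; rewrite Dp eqxx mul1r.
have C2 : has_csum [set: int * int]
    (fun p => (sg (p.1 - l) == sg (p.2 - k))%R%:Z%:~R * c p.1 p.2)
    (csum same_sg (fun p => c (p.1 + l) (p.2 + k))).
  (* Translation by [(l, k)] carries the same-sign pairs onto the support of the shifted
     indicator. *)
  apply: (has_csum_reindex (E := same_sg) (h := fun p => (p.1 + l, p.2 + k))).
  - by move=> [a b] [a' b'] _ _ /= [/addIr -> /addIr ->].
  - by [].
  - move=> p _ np; rewrite (_ : (_ == _) = false) ?mul0r//.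
    apply/eqP => Dp; apply: np; exists (p.1 - l, p.2 - k) => //=.
    by rewrite !subrK -surjective_pairing.
  - apply: eq_has_csum (has_csum_csum hc_shift) => p /set_mem Dp /=.
    by rewrite !addrK Dp eqxx mul1r.
have C3 : has_csum [set: int * int]
    (fun p => zsum 0 (l - 1) (fun r =>
      (r == p.1)%:R * ((sg p.2)%:~R * c r p.2)))
    (zsum 0 (l - 1) (fun r => csum [set: int] (fun s => (sg s)%:~R * c r s))).
  (* Each [r] contributes a family supported on the row [r], which the next line parametrizes by its
     second coordinate. *)
  apply: has_csum_zsum => r /hc_row/has_csum_csum Sr.
  apply: (has_csum_reindex (E := setT) (h := fun s => (r, s))).
  - by move=> s s' _ _ [].
  - by [].
  - move=> p _ np; rewrite (_ : (_ == _) = false) ?mul0r//.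
    apply/eqP => rp; apply: np; exists p.2 => //.
    by rewrite rp -surjective_pairing.
  - by apply: eq_has_csum Sr => s _ /=; rewrite eqxx mul1r.
have C4 : has_csum [set: int * int]
    (fun p => zsum 0 (k - 1) (fun s =>
      (s == p.2)%:R * ((sg p.1)%:~R * c p.1 s)))
    (zsum 0 (k - 1) (fun s => csum [set: int] (fun r => (sg r)%:~R * c r s))).
  apply: has_csum_zsum => s /hc_col/has_csum_csum Ss.
  apply: (has_csum_reindex (E := setT) (h := fun r => (r, s))).
  - by move=> r r' _ _ [].
  - by [].
  - move=> p _ np; rewrite (_ : (_ == _) = false) ?mul0r//.
    apply/eqP => sp; apply: np; exists p.1 => //.
    by rewrite sp -surjective_pairing.
  - by apply: eq_has_csum Ss => r _ /=; rewrite eqxx mul1r.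
have C5 : has_csum [set: int * int]
    (fun p => zsum 0 (l - 1) (fun r => zsum 0 (k - 1) (fun s =>
      (s == p.2)%:R * ((r == p.1)%:R * c r s))))
    (zsum 0 (l - 1) (fun r => zsum 0 (k - 1) (fun s => c r s))).
  apply: has_csum_zsum => r _; apply: has_csum_zsum => s _.
  (* For fixed [r] and [s], the two deltas leave a single point of the plane. *)
  apply: (has_csum_reindex (E := [set (r, s)]) (h := id)).
  - by [].
  - by [].
  - move=> p _ np; case: eqP => [sp|_]; last by rewrite mul0r.
    case: eqP => [rp|_]; last by rewrite mul0r mulr0.
    by case: np; exists p => //=; rewrite sp rp -surjective_pairing.
  - have S1 : has_csum [set (r, s)] (uncurry c) (c r s) by exact: has_csum_set1.
    apply: eq_has_csum S1 => p.
    by move=> /set_mem ->; rewrite /= !eqxx !mul1r.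
rewrite -(csumE C1); apply: csumE.
apply: eq_has_csum (has_csumD (has_csumD (has_csumD C2 C3) C4)
  (has_csumN (has_csumZ (a := 2) C5))) => -[r s] _ /=.
(* The inner sum is collapsed first, then the delta in [r] is moved to the front so that
   [zsum_delta] applies to the outer one. *)
under [X in 2 * zsum _ _ X]eq_fun do rewrite zsum_delta mulrCA.
rewrite !zsum_delta (same_sg_shift l k r s).
move: (zsum_sign 0 (l - 1) r) (zsum_sign 0 (k - 1) s) => e e'.
by rewrite rmorphB !rmorphD !rmorphM/=; ring.
Qed.
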